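(* For $\ell\in\{0,1,2,3,4\}$, there is no exotic coBUG containing $K_{1,\ell}$ as a connected component.
   Context: All graphs are finite, simple, undirected, with nonempty vertex set. For distinct vertices $v,w$ of a connected graph $G$, let $\sigma_{vw}$ be the number of shortest paths between $v$ and $w$, and $\sigma_{vw}(x)$ the number of those containing $x$ as an internal vertex (so $\sigma_{vw}(x)=0$ if $x\in\{v,w\}$). The betweenness of a vertex $x$ is $B_G(x)=\sum_{\{v,w\}\subseteq V(G)}\frac{\sigma_{vw}(x)}{\sigma_{vw}}$, the sum being over unordered pairs of distinct vertices. A betweenness-uniform graph (BUG) is a connected graph $G$ in which all vertices have the same betweenness; this common value is the betweenness of $G$. A low-betweenness BUG is a BUG with betweenness smaller than $1$. Stars are the graphs $K_{1,\ell}$ with $\ell\ge 0$ ($K_{1,0}$ is the single-vertex graph). An exotic BUG is a low-betweenness BUG whose complement is not a disjoint union of stars of the same size (i.e. there is no $\ell\ge0$ such that every connected component of the complement is isomorphic to $K_{1,\ell}$). An exotic coBUG is the complement of an exotic BUG. *)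

(* Defs.v *)
From HB Require Import structures.
From mathcomp Require Import all_boot all_order all_algebra.

Set Implicit Arguments.
Unset Strict Implicit.
Unset Printing Implicit Defensive.

Import Order.TTheory GRing.Theory Num.Theory.

Record sgraph := SGraph {
  vertex :> finType;
  adj : rel vertex;
  adj_sym : symmetric adj;
  adj_irrefl : irreflexive adj;
  vertex_gt0 : 0 < #|vertex|
}.

Definition isomorphic (G H : sgraph) : Prop :=
  exists2 f : G -> H, bijective f & forall x y, adj (f x) (f y) = adj x y.

Definition connected_graph (G : sgraph) : Prop :=
  forall x y : G, connect (@adj G) x y.

Section Complement.
Variable G : sgraph.

Definition compl_adj : rel G := [rel x y | (x != y) && ~~ adj x y].

Lemma compl_adj_sym : symmetric compl_adj.
Proof. by move=> x y; rewrite /compl_adj /= eq_sym adj_sym. Qed.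

Lemma compl_adj_irrefl : irreflexive compl_adj.
Proof. by move=> x; rewrite /compl_adj /= eqxx. Qed.

Definition complement : sgraph :=
  SGraph compl_adj_sym compl_adj_irrefl (vertex_gt0 G).
End Complement.

Section Component.
Variables (G : sgraph) (x : G).

Definition component_adj : rel {y : G | connect (@adj G) x y} :=
  [rel u v | adj (val u) (val v)].

Lemma component_adj_sym : symmetric component_adj.
Proof. by move=> u v; apply: adj_sym. Qed.

Lemma component_adj_irrefl : irreflexive component_adj.
Proof. by move=> u; apply: adj_irrefl. Qed.

Lemma component_gt0 : 0 < #|{: {y : G | connect (@adj G) x y}}|.
Proof. by apply/card_gt0P; exists (exist _ x (connect0 _ x)). Qed.

Definition component : sgraph :=
  SGraph component_adj_sym component_adj_irrefl component_gt0.
End Component.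

Section Star.
Variable l : nat.

Definition star_adj : rel 'I_l.+1 := [rel i j | (i == ord0) (+) (j == ord0)].

Lemma star_adj_sym : symmetric star_adj.
Proof. by move=> i j; apply: addbC. Qed.

Lemma star_adj_irrefl : irreflexive star_adj.
Proof. by move=> i; apply: addbb. Qed.

Lemma star_gt0 : 0 < #|'I_l.+1|.
Proof. by rewrite card_ord. Qed.

(* K_{1,l}, centred at ord0. *)
Definition star : sgraph := SGraph star_adj_sym star_adj_irrefl star_gt0.
End Star.

Section Betweenness.
Variable G : sgraph.

(* A path from v to w is represented by the sequence p of its vertices after
   v; since its vertices are distinct, #|G| bounds the length of p. *)
Definition is_path (v w : G) (p : seq G) : bool :=
  [&& path (@adj G) v p, last v p == w & uniq (v :: p)].

Definition shortest_paths (v w : G) : {set #|G|.-bseq G} :=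
  [set p : #|G|.-bseq G | is_path v w p
     & [forall q : #|G|.-bseq G, is_path v w q ==> (size p <= size q)]].

Definition sigma (v w : G) : nat := #|shortest_paths v w|.

Definition sigma_through (v w x : G) : nat :=
  #|[set p in shortest_paths v w | [&& x \in v :: p, x != v & x != w]]|.

(* Comparing ranks in the enumeration of the vertices selects exactly one
   orientation of each unordered pair {v, w}; which one is immaterial, see
   sigma_sym and sigma_through_sym below. *)
Definition betweenness (x : G) : rat :=
  (\sum_(v : G) \sum_(w : G | (enum_rank v < enum_rank w)%N)
     (sigma_through v w x)%:R / (sigma v w)%:R)%R.
End Betweenness.

Definition low_BUG (G : sgraph) : Prop :=
  connected_graph G /\
  exists2 b : rat, forall x : G, betweenness x = b & (b < 1)%R.

Definition union_of_equal_stars (G : sgraph) : Prop :=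
  exists l : nat, forall x : G, isomorphic (component x) (star l).

Definition exotic_BUG (G : sgraph) : Prop :=
  low_BUG G /\ ~ union_of_equal_stars (complement G).

Definition exotic_coBUG (H : sgraph) : Prop :=
  exists2 G : sgraph, exotic_BUG G & isomorphic H (complement G).

Section Symmetry.
Variable G : sgraph.

Let rpath (v : G) (p : seq G) := rev (belast v p).

Lemma size_rpath (v : G) p : size (rev (belast v p)) = size p.
Proof. by rewrite size_rev size_belast. Qed.

Lemma cons_rpath (v w : G) p : last v p = w -> w :: rpath v p = rev (v :: p).
Proof. by move=> <-; rewrite [in RHS]lastI rev_rcons. Qed.

Lemma is_path_rev (v w : G) p : is_path v w p -> is_path w v (rpath v p).
Proof.
case/and3P=> Pp /eqP Lp Up; apply/and3P; split.
- rewrite -Lp /rpath rev_path; rewrite (eq_path (e' := @adj G)) // => x y.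
  exact: adj_sym.
- have := cons_rpath Lp; rewrite rev_cons => E.
  by rewrite -(last_cons w) E last_rcons.
- by rewrite (cons_rpath Lp) rev_uniq.
Qed.

Definition rev_bseq (v : G) (p : #|G|.-bseq G) : #|G|.-bseq G :=
  insub_bseq #|G| (rpath v p).

Lemma rev_bseqE (v : G) (p : #|G|.-bseq G) : rev_bseq v p = rpath v p :> seq G.
Proof. by rewrite /rev_bseq /insub_bseq val_insubd size_rpath size_bseq. Qed.

Lemma shortest_paths_rev (v w : G) p :
  p \in shortest_paths v w -> rev_bseq v p \in shortest_paths w v.
Proof.
rewrite !inE rev_bseqE => /andP[Pp /forallP Mp]; rewrite is_path_rev //=.
apply/forallP => q; apply/implyP => /is_path_rev Pq.
have := Mp (rev_bseq w q); rewrite rev_bseqE Pq /= /rpath.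
by rewrite !size_rpath.
Qed.

Lemma rev_bseqK (v w : G) :
  {in shortest_paths v w, cancel (rev_bseq v) (rev_bseq w)}.
Proof.
move=> p; rewrite inE => /andP[/and3P[_ /eqP Lp _] _]; apply: val_inj.
rewrite [LHS]rev_bseqE rev_bseqE; have /= E := cons_rpath Lp.
have := congr1 rev E; rewrite revK lastI rev_rcons.
by case.
Qed.

Lemma sigma_through_sym_le (v w x : G) :
  sigma_through v w x <= sigma_through w v x.
Proof.
have inj : {in [set p in shortest_paths v w | [&& x \in v :: p, x != v & x != w]] &,
  injective (rev_bseq v)}.
  move=> p q; rewrite inE => /andP[Pp _]; rewrite inE => /andP[Pq _] E.
  by rewrite -(rev_bseqK Pp) E (rev_bseqK Pq).
rewrite /sigma_through -(card_in_imset inj); apply/subset_leq_card/subsetP.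
move=> _ /imsetP[p /[1!inE] /andP[Pp /and3P[xp xv xw]] ->].
rewrite inE shortest_paths_rev //= xv xw !andbT rev_bseqE.
move: Pp; rewrite inE => /andP[/and3P[_ /eqP Lp _] _].
by rewrite (cons_rpath Lp) mem_rev.
Qed.

Lemma sigma_sym_le (v w : G) : sigma v w <= sigma w v.
Proof.
rewrite /sigma -(card_in_imset (can_in_inj (@rev_bseqK v w))).
apply/subset_leq_card/subsetP => _ /imsetP[p Pp ->].
exact: shortest_paths_rev.
Qed.

Lemma sigma_sym (v w : G) : sigma v w = sigma w v.
Proof. by apply/eqP; rewrite eqn_leq !sigma_sym_le. Qed.

Lemma sigma_through_sym (v w x : G) : sigma_through v w x = sigma_through w v x.
Proof. by apply/eqP; rewrite eqn_leq !sigma_through_sym_le. Qed.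

Lemma sigma_gt0 (v w : G) : connect (@adj G) v w -> 0 < sigma v w.
Proof.
case/connectP=> p0 /shortenP[p Pp Up _] Lp.
have szp : size p <= #|G|.
  by apply: ltnW; rewrite -[X in X <= _]/(size (v :: p)) -(card_uniqP Up) max_card.
have Ip : is_path v w (Bseq szp) by rewrite /is_path Pp Up -Lp eqxx.
case: (@arg_minnP _ (Bseq szp) (fun q : #|G|.-bseq G => is_path v w q)
  (fun q : #|G|.-bseq G => size q) Ip) => q Iq Mq.
apply/card_gt0P; exists q; rewrite inE Iq.
by apply/forallP => r; apply/implyP => /Mq.
Qed.
End Symmetry.

(* Main.v *)
Require Import Defs.
From HB Require Import structures.
From mathcomp Require Import all_boot all_order all_algebra.
From mathcomp Require Import zify.

(* Let T be the complement of G, n the number of vertices, and suppose that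
   every edge of T misses the neighbourhoods of some vertex, so that G has
   diameter at most 2.  A pair vw contributes to betweenness in G only if it is
   an edge of T, and then it gives 1 / s to each of the s = n - |N(v) u N(w)|
   vertices outside N(v) u N(w).  Hence "all betweennesses are equal" means that
   the weights 1 / s of the edges vw of T with x in N(v) u N(w) (the edges near
   x) have a sum independent of x.
   At the centre of a component K_{1,l} this sum is l / (n - l - 1), and
   betweenness below 1 forces l < n - l - 1.  If w is a leaf attached to v, the
   edges near w are among those near v, so they coincide and the component is a
   star, with l leaves again.  A component of minimum degree at least 2 is
   impossible: if it is a triangle the sum is wrong; otherwise every edge has
   |N(v) u N(w)| >= 4, every vertex is near at least 4 edges, and for l <= 4
   this leaves only l = 4, exactly 4 edges near each vertex and all degrees 2,
   where the sum is again wrong. *)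

Set Implicit Arguments.
Unset Strict Implicit.
Unset Printing Implicit Defensive.

Import Order.TTheory GRing.Theory Num.Theory.

(** * Edge weights and the edges near a vertex *)

Section EdgeWeights.
Variable T : sgraph.
Implicit Types (a b c v w x y z : T) (p : T * T).

Definition nbrs x : {set T} := [set y | adj x y].
Definition edge_nbrs p : {set T} := nbrs p.1 :|: nbrs p.2.
(* Ordered pairs, so that every edge is counted twice. *)
Definition edges_near x : {set T * T} :=
  [set p | adj p.1 p.2 & x \in edge_nbrs p].
Definition edge_weight p : rat := (#|~: edge_nbrs p|%:R^-1)%R.
Definition near_weight x : rat := (\sum_(p in edges_near x) edge_weight p)%R.
(* Isolated vertices are included, as centres of K_{1,0}. *)
Definition star_center c := forall y z, adj c y -> adj y z -> z = c.

Lemma in_edge_nbrs x p : (x \in edge_nbrs p) = adj p.1 x || adj p.2 x.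
Proof. by rewrite !inE. Qed.

Lemma in_edges_near x p :
  (p \in edges_near x) = adj p.1 p.2 && (adj p.1 x || adj p.2 x).
Proof. by rewrite !inE. Qed.

Lemma nbrs_irrefl x : x \notin nbrs x.
Proof. by rewrite inE adj_irrefl. Qed.

(** Bridges sums over ordered pairs and the rank-oriented sum in [betweenness]; over [nat] it yields
    a parity. *)
Lemma sum_sym_rank (V : nmodType) (f : T -> T -> V) :
    (forall a b, f a b = f b a) -> (forall a, f a a = 0%R) ->
  (\sum_a \sum_b f a b =
    (\sum_a \sum_(b | (enum_rank a < enum_rank b)%N) f a b) *+ 2)%R.
Proof.
move=> fC f0; rewrite GRing.mulr2n.
rewrite [X in _ = (_ + X)%R](exchange_big_dep predT) //= -big_split /=.
apply: eq_bigr => a _; rewrite (bigID (fun b => enum_rank a < enum_rank b)) /=.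
congr (_ + _)%R; rewrite [LHS](bigD1 a) ?ltnn //= f0 GRing.add0r.
apply: eq_big => [b|b _]; last exact: fC.
by rewrite -leqNgt ltn_neqAle andbC (inj_eq val_inj) (inj_eq enum_rank_inj).
Qed.

Lemma edges_near_even x : ~~ odd #|edges_near x|.
Proof.
rewrite -sum1dep_card big_mkcond.
pose f a b : nat := if (a, b) \in edges_near x then 1 else 0.
rewrite (eq_bigr (fun p => f p.1 p.2)) => [|[a b] _]; last by rewrite /f !inE.
rewrite -(pair_bigA _ f) /= [X in odd X](sum_sym_rank (V := nat)).
- by move: (\sum_a _)%R => k; rewrite GRing.mulr2n oddD addbb.
- by move=> a b; rewrite /f !in_edges_near /= adj_sym orbC.
- by move=> a; rewrite /f in_edges_near /= adj_irrefl.
Qed.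

Lemma card_arcs (D : {set T}) :
  #|[set p : T * T | (p.1 \in D) && adj p.1 p.2]| = \sum_(a in D) #|nbrs a|.
Proof.
rewrite -sum1dep_card -(pair_big_dep (mem D) (fun a b => adj a b) (fun _ _ => 1)).
by apply: eq_bigr => a _; rewrite sum1_card /nbrs cardsE.
Qed.

(** An arc leaving x has its head adjacent to x, and an arc leaving a neighbour of x is near x
    through its tail. The arcs missed are those entering a neighbour of x from outside the closed
    neighbourhood. *)
Lemma sub_edges_near x :
  [set p : T * T | (p.1 \in x |: nbrs x) && adj p.1 p.2] \subset edges_near x.
Proof.
apply/subsetP => p; rewrite in_edges_near !inE => /andP[/orP[/eqP <-|xp] e].
  by rewrite [adj p.2 _]adj_sym e orbT.
by rewrite e adj_sym xp.
Qed.

Lemma sum_deg_near_le x : \sum_(a in x |: nbrs x) #|nbrs a| <= #|edges_near x|.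
Proof. by rewrite -card_arcs subset_leq_card ?sub_edges_near. Qed.

Lemma card_cnbrs x : #|x |: nbrs x| = #|nbrs x|.+1.
Proof. by rewrite cardsU1 nbrs_irrefl. Qed.

(** Each end of an edge is a neighbour of the other, so open and closed neighbourhoods have the same
    union. *)
Lemma edge_nbrsE p :
  adj p.1 p.2 -> edge_nbrs p = (p.1 |: nbrs p.1) :|: (p.2 |: nbrs p.2).
Proof.
move=> e; rewrite setUACA; apply/esym/setUidPr/subsetP => x.
rewrite in_edge_nbrs => /set2P[] ->; last by rewrite e.
by rewrite [adj p.2 _]adj_sym e orbT.
Qed.

Lemma near_weight_const x u :
    (forall p, p \in edges_near x -> #|edge_nbrs p| = u) ->
  (near_weight x = #|edges_near x|%:R / (#|T| - u)%:R)%R.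
Proof.
move=> hu; rewrite /near_weight (eq_bigr (fun=> ((#|T| - u)%:R^-1)%R)).
  by rewrite sumr_const GRing.mulr_natl.
by move=> p /hu <-; rewrite /edge_weight cardsCs setCK.
Qed.

Lemma frac_eq_nat (a b c d : nat) : 0 < b -> 0 < d ->
  (a%:R / b%:R = c%:R / d%:R :> rat)%R -> a * d = c * b.
Proof.
move=> b0 d0 /eqP; rewrite GRing.eqr_div ?pnatr_eq0 -?lt0n //.
by rewrite -!natrM eqr_nat => /eqP.
Qed.

Lemma frac_le_nat (a b c d : nat) : 0 < b -> 0 < d ->
  (a%:R / b%:R <= c%:R / d%:R :> rat)%R -> a * d <= c * b.
Proof.
move=> b0 d0; rewrite ler_pdivrMr ?ltr0n // GRing.mulrAC.
by rewrite ler_pdivlMr ?ltr0n // -!natrM ler_nat.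
Qed.

Lemma star_center_leaf c z : star_center c -> adj c z -> nbrs z = [set c].
Proof.
move=> hc cz; apply/setP => y; rewrite !inE; apply/idP/eqP => [/(hc _ _ cz)//|->].
by rewrite adj_sym.
Qed.

(** The edges near c are exactly the edges at c, each counted in both orders, and each has the
    closed neighbourhood of c as [edge_nbrs]. *)
Lemma star_center_weight c : star_center c ->
  (near_weight c = (#|nbrs c|.*2)%:R / (#|T| - #|nbrs c|.+1)%:R)%R.
Proof.
move=> hc; have closed p : p \in edges_near c ->
    (p.1 = c) /\ adj c p.2 \/ (p.2 = c) /\ adj c p.1.
  rewrite in_edges_near => /andP[e /orP[] pc].
    by right; have cp : adj c p.1 by [rewrite adj_sym]; rewrite (hc _ _ cp e).
  have cp : adj c p.2 by rewrite adj_sym.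
  by left; rewrite (hc _ p.1 cp) // adj_sym.
rewrite (near_weight_const (u := #|nbrs c|.+1)); last first.
  case=> a b /closed /= [[->]|[->]] e; rewrite /edge_nbrs /= (star_center_leaf hc e).
    by rewrite setUC cardsU1 nbrs_irrefl.
  by rewrite cardsU1 nbrs_irrefl.
congr (_%:R / _)%R.
suff -> : edges_near c = [set p | (p.1 \in c |: nbrs c) && adj p.1 p.2].
  rewrite card_arcs big_setU1 ?nbrs_irrefl //= -addnn; congr addn.
  rewrite (eq_bigr (fun=> 1)) ?sum1_card // => z; rewrite inE => cz.
  by rewrite (star_center_leaf hc cz) cards1.
apply/eqP; rewrite eqEsubset sub_edges_near andbT; apply/subsetP => p pc.
have := pc; rewrite in_edges_near !inE => /andP[-> _]; rewrite andbT.
by case: (closed _ pc) => -[pE e]; rewrite ?pE ?eqxx ?e ?orbT.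
Qed.

(** * Graphs in which all near weights agree *)

Section UniformNearWeight.
Hypothesis near_weight_eq : forall x y, near_weight x = near_weight y.
Hypothesis edge_nbrs_proper : forall p, adj p.1 p.2 -> #|edge_nbrs p| < #|T|.

Lemma edge_weight_gt0 p : adj p.1 p.2 -> (0 < edge_weight p)%R.
Proof.
move=> /edge_nbrs_proper h.
by rewrite invr_gt0 ltr0n cardsCs setCK subn_gt0.
Qed.

(* The edges near w are among those near v, with the same total weight. *)
Lemma edges_near_dominated v w :
  nbrs w \subset v |: nbrs v -> adj v w -> edges_near v = edges_near w.
Proof.
move=> wv vw.
have sub : edges_near w \subset edges_near v.
  apply/subsetP => p; rewrite !in_edges_near => /andP[e].
  rewrite e /= => /orP[] pw.
    have: p.1 \in nbrs w by rewrite inE adj_sym.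
    move/(subsetP wv); rewrite !inE => /orP[/eqP <-|]; last by rewrite adj_sym => ->.
    by rewrite [X in _ || X]adj_sym e orbT.
  have: p.2 \in nbrs w by rewrite inE adj_sym.
  move/(subsetP wv); rewrite !inE => /orP[/eqP <-|]; last by rewrite [adj v _]adj_sym => ->; rewrite orbT.
  by rewrite e.
have := near_weight_eq v w; rewrite /near_weight (big_setID (edges_near w)) /=.
rewrite (setIidPr sub) => /eqP; rewrite -[X in _ == X]GRing.addr0 (inj_eq (GRing.addrI _)).
move=> /eqP h; apply/eqP; rewrite eqEsubset sub andbT; apply/subsetP => p pv.
apply/negPn/negP => pw; have e : adj p.1 p.2 by move: pv; rewrite in_edges_near => /andP[].
have pD : p \in edges_near v :\: edges_near w by apply/setDP.
have := edge_weight_gt0 e; suff -> : edge_weight p = 0%R by rewrite ltxx.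
have pos q : q \in edges_near v :\: edges_near w -> (0 <= edge_weight q)%R.
  by case/setDP; rewrite in_edges_near => /andP[f _] _; apply/ltW/edge_weight_gt0.
by apply/eqP; move/eqP: h; rewrite psumr_eq0 // => /allP/(_ p); rewrite mem_index_enum pD; apply.
Qed.

(** A leaf w is dominated by v, so every edge near v is near w, which means that it has v as an
    end. *)
Lemma leaf_star_center v w : nbrs w = [set v] -> star_center v.
Proof.
move=> wv z t vz zt.
have vw : adj v w by have := set11 v; rewrite -wv inE adj_sym.
have: (z, t) \in edges_near w.
  rewrite -(@edges_near_dominated v w) //; last by rewrite wv sub1set setU11.
  by rewrite in_edges_near /= zt adj_sym vz.
rewrite in_edges_near /= zt /= ![adj _ w]adj_sym.
have wE y : adj w y = (y == v) by have := in_set1 y v; rewrite -wv inE.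
rewrite !wE => /orP[] /eqP // zv.
by move: vz; rewrite zv adj_irrefl.
Qed.

Section StarCenter.
Variables (c : T) (l : nat).
Hypothesis c_center : star_center c.
Hypothesis deg_c : #|nbrs c| = l.
Hypothesis l_lt : l < #|T| - l.+1.

Lemma near_weightE x : (near_weight x = (l.*2)%:R / (#|T| - l.+1)%:R)%R.
Proof. by rewrite (near_weight_eq x c) star_center_weight // deg_c. Qed.

(** The map sending d to 2d / (n - d - 1) is injective for d + 1 < n. *)
Lemma star_center_deg x : star_center x -> #|nbrs x| = l.
Proof.
move=> hx; have := near_weightE x; rewrite star_center_weight //.
have lt : #|nbrs x|.+1 < #|T|.
  have [d0|] := posnP #|nbrs x|; first by rewrite d0; lia.
  case/card_gt0P => y; rewrite inE => xy.
  have := @edge_nbrs_proper (x, y) xy.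
  rewrite /edge_nbrs /= (star_center_leaf hx xy) setUC cardsU1.
  by rewrite nbrs_irrefl.
by move=> /frac_eq_nat h; have {h} := h ltac:(lia) ltac:(lia); nia.
Qed.

(** * Excluding components of minimum degree at least two *)

Section MinDegreeTwo.
Variable x0 : T.
Hypothesis l_le4 : l <= 4.
Hypothesis deg_ge2 : forall y, connect (@adj T) x0 y -> 1 < #|nbrs y|.

Let connect_adj y z : connect (@adj T) x0 y -> adj y z -> connect (@adj T) x0 z.
Proof. by move=> xy /connect1; apply: connect_trans. Qed.

(* Otherwise v and w have a single common neighbour y, domination of v by y
   makes {v, w, y} a triangle component, and near_weight is wrong there. *)
Lemma card_edge_nbrs_gt3 v w :
  connect (@adj T) x0 v -> adj v w -> 3 < #|edge_nbrs (v, w)|.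
Proof.
move=> xv vw; rewrite ltnNge; apply/negP; set U := edge_nbrs (v, w) => U3.
have xw := connect_adj xv vw.
have UE : U = (v |: nbrs v) :|: (w |: nbrs w) by rewrite /U edge_nbrsE.
have Uv : v |: nbrs v = U.
  apply/eqP; rewrite eqEcard {1}UE subsetUl card_cnbrs.
  by rewrite (leq_trans U3) ?ltnS ?deg_ge2.
have Uw : w |: nbrs w = U.
  apply/eqP; rewrite eqEcard {1}UE subsetUr card_cnbrs.
  by rewrite (leq_trans U3) ?ltnS ?deg_ge2.
have cardU : #|U| = 3.
  by apply/eqP; rewrite eqn_leq U3 -Uv card_cnbrs ltnS deg_ge2.
have clique y : y \in U -> y |: nbrs y = U.
  move=> yU; have [->//|yv] := eqVneq y v; have [->//|yw] := eqVneq y w.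
  have vy : adj v y by move: yU; rewrite -Uv !inE (negPf yv).
  have wy : adj w y by move: yU; rewrite -Uw !inE (negPf yw).
  have yx := connect_adj xv vy.
  have vNw : v != w by apply: contraTneq vw => ->; rewrite adj_irrefl.
  have UvwyE : [set v; w; y] = U.
    apply/eqP; rewrite eqEcard cardU !subUset !sub1set.
    rewrite yU -{1}Uv setU11 -{1}Uw setU11 /=.
    by rewrite setUC cardsU1 cards2 vNw !inE (negPf yv) (negPf yw).
  have Uy : U \subset y |: nbrs y.
    by rewrite -UvwyE !subUset !sub1set !inE eqxx /= ![adj y _]adj_sym vy wy !orbT.
  have near_yv : edges_near y = edges_near v.
    apply: edges_near_dominated; last by rewrite adj_sym.
    by rewrite (subset_trans _ Uy) // -Uv subsetUr.
  apply/eqP; rewrite eqEsubset Uy andbT; apply/subsetP => z.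
  case/setU1P => [->//|]; rewrite inE => yz; apply/negPn/negP => zU.
  (* A second neighbour z' of z makes zz' an edge near y, hence near v; each way this can happen
     puts z in U. *)
  have := deg_ge2 (connect_adj yx yz); rewrite (cardsD1 y) inE adj_sym yz add1n ltnS.
  case/card_gt0P => z' /setD1P[z'y]; rewrite inE => zz'.
  have: (z, z') \in edges_near v by rewrite -near_yv in_edges_near /= zz' adj_sym yz.
  rewrite in_edges_near /= zz' /= => /orP[zv|z'v].
    by case/negP: zU; rewrite -Uv !inE [adj v z]adj_sym zv orbT.
  have: z' \in U by rewrite -Uv !inE [adj v z']adj_sym z'v orbT.
  rewrite -UvwyE !inE (negPf z'y) orbF => /orP[] /eqP z'E.
    by rewrite z'E adj_irrefl in z'v.
  by case/negP: zU; rewrite -Uw !inE -z'E [adj z' z]adj_sym zz' orbT.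
have degU y : y \in U -> #|nbrs y| = 2.
  by move=> yU; have := card_cnbrs y; rewrite clique // cardU => -[].
have sub1 p : p \in edges_near v -> p.1 \in U.
  rewrite in_edges_near => /andP[e /orP[] pv].
    by rewrite -Uv !inE [adj v _]adj_sym pv orbT.
  have p2U : p.2 \in U by rewrite -Uv !inE [adj v _]adj_sym pv orbT.
  by rewrite -(clique _ p2U) !inE [adj p.2 _]adj_sym e orbT.
have near_v : edges_near v = [set p | (p.1 \in v |: nbrs v) && adj p.1 p.2].
  apply/eqP; rewrite eqEsubset sub_edges_near andbT; apply/subsetP => p pv.
  by rewrite in_set Uv sub1 //; move: pv; rewrite in_edges_near => /andP[].
(* The equation 6 / (n - 3) = 2l / (n - l - 1) amounts to n (3 - l) = 3, impossible for n > 3. *)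
have := near_weightE v; rewrite (near_weight_const (u := 3)).
  rewrite near_v card_arcs Uv (eq_bigr (fun=> 2)) // sum_nat_const cardU.
  have := @edge_nbrs_proper (v, w) vw; rewrite cardU => n3.
  move=> /frac_eq_nat h; have {h} := h ltac:(lia) ltac:(lia).
  by case: l l_le4 l_lt => [|[|[|[|[|l']]]]]; lia.
move=> p pv; have p1U := sub1 p pv; move: pv; rewrite in_edges_near => /andP[e _].
have p2U : p.2 \in U by rewrite -(clique _ p1U) !inE e orbT.
by rewrite edge_nbrsE // !clique // setUid.
Qed.

Let near_connect x p :
  connect (@adj T) x0 x -> p \in edges_near x -> connect (@adj T) x0 p.1.
Proof.
move=> xx; rewrite in_edges_near => /andP[e /orP[] px].
  by apply: connect_adj xx _; rewrite adj_sym.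
by apply: connect_adj (connect_adj xx _) _; rewrite adj_sym; [exact: px | exact: e].
Qed.

(** By parity seven arcs suffice. At least 3 deg x arcs leave the closed neighbourhood of x, which
    is enough when deg x >= 3. When deg x = 2, that neighbourhood has three elements, so an edge xy
    has some z outside it in its [edge_nbrs], and (z, y) is a seventh arc. *)
Lemma card_edges_near_ge8 x : connect (@adj T) x0 x -> 8 <= #|edges_near x|.
Proof.
move=> xx; suff : 6 < #|edges_near x|.
  by have := edges_near_even x; rewrite leq_eqVlt => /[swap] /orP[/eqP <-|].
have sum_ge : (#|nbrs x| * 3) <= \sum_(a in x |: nbrs x) #|nbrs a|.
  rewrite big_setU1 ?nbrs_irrefl //= mulnS leq_add2l -sum_nat_const.
  by apply: leq_sum => z; rewrite inE => /(connect_adj xx) /deg_ge2.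
have [deg3|] := ltnP 2 #|nbrs x|; first by have := sum_deg_near_le x; lia.
move=> deg_le2; have deg2 := deg_ge2 xx.
have /card_gt0P[y] : 0 < #|nbrs x| by lia.
rewrite inE => xy; have := card_edge_nbrs_gt3 xx xy.
have [/subset_leq_card|/subsetPn[z zU zx]] := boolP (edge_nbrs (x, y) \subset x |: nbrs x).
  by rewrite card_cnbrs; lia.
move=> _; have zy : adj z y.
  by move: zU zx; rewrite in_edge_nbrs !inE /= adj_sym => /orP[-> /norP[]//|]; rewrite adj_sym.
rewrite (leq_ltn_trans (leq_trans _ sum_ge)) //; first by lia.
rewrite -card_arcs proper_card // properE sub_edges_near /=.
apply/subsetPn; exists (z, y); first by rewrite in_edges_near /= zy [adj y x]adj_sym xy orbT.
by rewrite in_set /= (negPf zx).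
Qed.

Lemma min_degree_two_false : False.
Proof.
have gt3 x p : connect (@adj T) x0 x -> p \in edges_near x -> 3 < #|edge_nbrs p|.
  move=> xx px; have := near_connect xx px.
  by move: px; rewrite in_edges_near => /andP[e _]; case: p e => a b /= e /card_edge_nbrs_gt3/(_ e).
have n4 : 4 < #|T|.
  have := deg_ge2 (connect0 _ x0); case/ltnW/card_gt0P => y; rewrite inE => xy.
  exact: leq_ltn_trans (card_edge_nbrs_gt3 (connect0 _ x0) xy) (@edge_nbrs_proper (x0, y) xy).
(* Each edge near x has weight at least 1 / (n - 4). *)
have le x : connect (@adj T) x0 x -> #|edges_near x| * (#|T| - l.+1) <= l.*2 * (#|T| - 4).
  move=> xx; apply: frac_le_nat; [lia | lia |].
  rewrite -(near_weightE x) /near_weight GRing.mulr_natl -sumr_const ler_sum // => p px.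
  have p3 := gt3 _ _ xx px; move: px; rewrite in_edges_near => /andP[/edge_nbrs_proper pn _].
  rewrite /edge_weight cardsCs setCK lef_pV2 ?posrE ?ltr0n ?ler_nat; lia.
(* With eight arcs the bound becomes (4 - l) n <= 4, while n > 4. *)
have l4 : l = 4.
  have := le _ (connect0 _ x0); have := card_edges_near_ge8 (connect0 _ x0).
  by case: l l_le4 l_lt => [|[|[|[|[|l']]]]] //; nia.
(* Ten arcs would force n <= 9, whereas [l_lt] with l = 4 gives n >= 10; parity excludes nine. *)
have near8 x : connect (@adj T) x0 x -> #|edges_near x| = 8.
  move=> xx; have := le _ xx; have := card_edges_near_ge8 xx; have := edges_near_even x.
  move: l_lt; rewrite l4 => lt4 ev ge8 le8.
  suff : #|edges_near x| < 10 by move: #|_| ev ge8 => -[|[|[|[|[|[|[|[|[|[|k]]]]]]]]]].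
  by nia.
have deg2 x : connect (@adj T) x0 x -> #|nbrs x| = 2.
  move=> xx; have := sum_deg_near_le x; rewrite near8 // big_setU1 ?nbrs_irrefl //=.
  have : #|nbrs x| * 2 <= \sum_(a in nbrs x) #|nbrs a|.
    rewrite -sum_nat_const; apply: leq_sum => z.
    by rewrite inE => /(connect_adj xx) /deg_ge2.
  have := deg_ge2 xx; lia.
(* Every edge near [x0] now has exactly four vertices in its [edge_nbrs], giving 8 / (n - 4) = 8 /
   (n - 5). *)
have := near_weightE x0; rewrite (near_weight_const (u := 4)); last first.
  move=> p px; apply/eqP; rewrite eqn_leq (gt3 _ _ (connect0 _ x0) px) andbT.
  have xp := near_connect (connect0 _ x0) px.
  move: px; rewrite in_edges_near => /andP[e _].
  apply: leq_trans (leq_card_setU _ _) _.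
  by rewrite !deg2 //; apply: connect_adj xp e.
rewrite near8 ?connect0 // l4 => /frac_eq_nat h.
by have := l_lt; have := h ltac:(lia) ltac:(lia); lia.
Qed.

End MinDegreeTwo.

(** The component of x has a vertex of degree at most 1: the neighbour of a leaf is a centre, and an
    isolated vertex is its own. *)
Lemma connect_star_center x : l <= 4 ->
  exists2 c', connect (@adj T) x c' & star_center c'.
Proof.
move=> l4.
have [/existsP[w /andP[xw]]|/existsPn nw] :=
    boolP [exists w, connect (@adj T) x w && (#|nbrs w| <= 1)]; last first.
  case: (@min_degree_two_false x l4) => y xy.
  by have := nw y; rewrite xy /= -ltnNge.
rewrite leq_eqVlt ltnS leqn0 => /orP[/cards1P[v wv]|].
  exists v; last exact: leaf_star_center wv.
  apply: connect_trans xw (connect1 _).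
  by have := set11 v; rewrite -wv inE.
by rewrite cards_eq0 => /eqP w0; exists w => // y z wy; have := in_set0 y; rewrite -w0 inE wy.
Qed.

End StarCenter.
End UniformNearWeight.
End EdgeWeights.

(** * Star components and their centres *)

Section StarComponents.
Variables (T : sgraph) (l : nat).
Implicit Types (c x y z : T).

Lemma star_center_closed c :
  star_center c -> closed (@adj T) (mem (c |: nbrs c)).
Proof.
move=> hc; apply: intro_closed; first exact/sym_connect_sym/adj_sym.
move=> x y xy; rewrite !inE => /orP[/eqP <-|cx]; first by rewrite xy orbT.
by rewrite (hc _ _ cx xy) eqxx.
Qed.

Lemma isomorphic_star_component x : isomorphic (component x) (star l) ->
  exists2 c : T, star_center c & #|nbrs c| = l.
Proof.
case=> f f_bij f_adj; have [g fK gK] := f_bij; pose u0 := g ord0.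
have ext (u : component x) y (uy : adj (val u) y) : connect (@adj T) x y.
  exact: connect_trans (valP u) (connect1 uy).
have f0 u : (f u == ord0) = (u == u0) by rewrite -(can_eq fK) gK.
have adjE u v : adj (val u) (val v) = (u == u0) (+) (v == u0).
  by rewrite -!f0; have := f_adj u v.
exists (val u0).
  move=> y z; move=> uy yz; pose u : component x := exist _ y (ext u0 y uy).
  pose v : component x := exist _ z (ext u z yz).
  have := adjE u0 u; have := adjE u v; rewrite /= uy yz eqxx.
  by case: (u == u0) => //= /esym/eqP/(congr1 val).
have -> : nbrs (val u0) = [set val u | u in [set~ u0]].
  apply/setP => y; apply/idP/imsetP => [|[u]].
    rewrite inE => uy; exists (exist _ y (ext u0 y uy)) => //.
    by have := adjE u0 (exist _ y (ext u0 y uy)); rewrite !inE /= uy eqxx => /esym.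
  by rewrite !inE => uu0 ->; rewrite adjE eqxx (negPf uu0).
rewrite (card_imset _ val_inj) cardsC1 (bij_eq_card f_bij).
by rewrite [#|_|]card_ord.
Qed.

Lemma star_center_isomorphic c x : star_center c -> #|nbrs c| = l ->
  connect (@adj T) x c -> isomorphic (component x) (star l).
Proof.
move=> hc deg_c xc; have sym := sym_connect_sym (@adj_sym T).
have inC y : connect (@adj T) x y = (y \in c |: nbrs c).
  apply/idP/idP => [xy|].
    have : connect (@adj T) c y by apply: connect_trans xy; rewrite sym.
    by move/(closed_connect (star_center_closed hc)) <-; rewrite setU11.
  case/setU1P => [->//|]; rewrite inE => cy.
  exact: connect_trans xc (connect1 cy).
have leaf (u : component x) : val u != c -> val u \in nbrs c.
  by move=> uc; have := valP u; rewrite /= inC in_setU1 (negPf uc).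
pose f (u : component x) : star l :=
  if val u == c then ord0 else inord (index (val u) (enum (nbrs c))).+1.
(* [inord] would fall back to [ord0] out of range; leaves lie in the enumeration, so their index is
   below l. *)
have fE u : f u = (if val u == c then 0 else (index (val u) (enum (nbrs c))).+1) :> nat.
  rewrite /f; have [//|uc] := eqVneq; rewrite inordK // ltnS -[ltnRHS]deg_c cardE.
  by rewrite index_mem mem_enum leaf.
have f0 u : (f u == ord0) = (val u == c).
  by rewrite -val_eqE /= fE; case: ifP.
have f_inj : injective f.
  move=> u v /(congr1 val) /=; rewrite !fE.
  have [uc|uc] := eqVneq (val u) c; have [vc|vc] := eqVneq (val v) c => //.
    by move=> _; apply: val_inj; rewrite uc vc.
  case=> E; have mem (u' : component x) : val u' != c -> val u' \in enum (nbrs c).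
    by rewrite mem_enum; apply: leaf.
  by apply: val_inj; rewrite -(nth_index c (mem u uc)) E nth_index ?mem.
exists f.
  apply: inj_card_bij => //; rewrite card_sig (eq_card (B := mem (c |: nbrs c))).
    by rewrite card_cnbrs deg_c [#|_|]card_ord.
  by move=> y; rewrite inE inC.
move=> u v; transitivity ((f u == ord0) (+) (f v == ord0)) => //.
rewrite !f0 -[RHS]/(adj (val u) (val v)).
have [ucE|uc] := eqVneq (val u) c; have [vcE|vc] := eqVneq (val v) c.
- by rewrite ucE vcE adj_irrefl.
- by rewrite ucE; have := leaf v vc; rewrite inE => ->.
- by rewrite vcE adj_sym; have := leaf u uc; rewrite inE => ->.
- apply/esym/negbTE/negP => uv; have := leaf u uc; rewrite inE => cu.
  by rewrite (hc _ _ cu uv) eqxx in vc.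
Qed.

End StarComponents.

Lemma isomorphic_star_center (H K : sgraph) (c : H) : isomorphic H K -> star_center c ->
  exists2 c' : K, star_center c' & #|nbrs c'| = #|nbrs c|.
Proof.
case=> f f_bij f_adj hc; have [g fK gK] := f_bij.
exists (f c).
  by move=> y z; rewrite -[y]gK -[z]gK !f_adj => cy yz; rewrite (hc _ _ cy yz).
rewrite -(card_imset (mem (nbrs c)) (bij_inj f_bij)); apply: eq_card => y.
by rewrite -[y]gK mem_imset ?inE ?f_adj //; apply: bij_inj.
Qed.

(** * Betweenness in G through the edges of its complement *)

Section ComplementBetweenness.
Variable G : sgraph.
Local Notation T := (complement G).
Implicit Types (v w x z : G).

Lemma complementE v w : @adj T v w = (v != w) && ~~ adj v w.
Proof. by []. Qed.

(** The ends v and w satisfy neither side, being neighbours of each other in T; for other z, not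
    adjacent in T means adjacent in G. *)
Lemma common_nbrE v w z : @adj T v w ->
  ((z : T) \notin @edge_nbrs T (v : T, w : T)) = adj v z && adj z w.
Proof.
rewrite in_edge_nbrs !complementE /= => /andP[vw nvw].
have [<-|vz] := eqVneq v z; first by rewrite adj_irrefl adj_sym nvw eq_sym vw.
have [<-|wz] := eqVneq w z; first by rewrite adj_irrefl andbF nvw.
by rewrite /= -negb_and negbK [adj w z]adj_sym.
Qed.

Lemma shortest_path_size v w (p q : #|G|.-bseq G) :
  p \in shortest_paths v w -> is_path v w q -> size p <= size q.
Proof. by rewrite inE => /andP[_ /forallP/(_ q)/implyP]. Qed.

Lemma sigma_through_adj v w x : adj v w -> sigma_through v w x = 0.
Proof.
move=> vw; apply: eq_card0 => p; rewrite !inE; apply/negP => /andP[p_sp].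
have vNw : v != w by apply: contraTneq vw => ->; rewrite adj_irrefl.
have size1 : size [:: w] <= #|G| by exact: vertex_gt0.
have q_path : is_path v w (Bseq size1) by rewrite /is_path /= vw eqxx inE vNw.
have p_short : p \in shortest_paths v w by rewrite inE.
have /= := shortest_path_size p_short q_path.
case/andP: p_sp => /and3P[_ + _] _; case: (val p) => [|a [|b s]] //=.
  by rewrite (negPf vNw).
by move=> /eqP -> _; rewrite !inE => /and3P[/orP[] ->]; rewrite ?andbF.
Qed.

Section NonAdjacent.
Variables (v w : G).
Hypothesis vw : @adj T v w.

Let two_path z : #|G|.-bseq G := insub_bseq #|G| [:: z; w].

Let two_pathE z : val (two_path z) = [:: z; w].
Proof.
rewrite /two_path /insub_bseq val_insubd /=; case: ifP => // /negP[].
(* Two distinct vertices exist, so the length bound is at least 2 and [insub_bseq] does not take its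
   default. *)
have /andP[vNw _] := vw; have := max_card (mem [set v; w]).
by rewrite cards2 vNw.
Qed.

Let two_path_inj : injective two_path.
Proof. by move=> y z /(congr1 val); rewrite !two_pathE => -[]. Qed.

Let is_path_two z : (z : T) \notin @edge_nbrs T (v : T, w : T) -> is_path v w (two_path z).
Proof.
rewrite common_nbrE // => /andP[vz zw]; rewrite /is_path two_pathE /= vz zw eqxx.
have /andP[vNw _] := vw; rewrite !inE negb_or vNw !andbT /=.
apply/andP; split; first by apply: contraTneq vz => ->; rewrite adj_irrefl.
by apply: contraTneq zw => ->; rewrite adj_irrefl.
Qed.

Let size_path (p : seq G) : is_path v w p -> 1 < size p.
Proof.
have /andP[vNw nvw] := vw; case: p => [|a [|b s]] //; rewrite /is_path /=.
  by rewrite (negPf vNw).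
by case/and3P => /andP[va _] /eqP aw; rewrite -aw va in nvw.
Qed.

Hypothesis common : #|@edge_nbrs T (v : T, w : T)| < #|G|.

(** By [common] there is a path of length two, and nonadjacent vertices have no shorter one, so
    shortest paths correspond to common neighbours in G. *)
Lemma shortest_paths_nonadj :
  shortest_paths v w = [set two_path z | z in ~: @edge_nbrs T (v : T, w : T)].
Proof.
apply/setP => p; apply/idP/imsetP => [p_sp|[z]]; last first.
  rewrite in_setC => zU ->; rewrite inE is_path_two //=.
  by apply/forallP => q; apply/implyP => /size_path; rewrite two_pathE.
have /card_gt0P[z] : 0 < #|~: @edge_nbrs T (v : T, w : T)| by rewrite cardsCs setCK subn_gt0.
rewrite in_setC => /is_path_two /(shortest_path_size p_sp); rewrite two_pathE => p2.
move: p_sp; rewrite inE => /andP[pp _]; have := size_path pp.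
case E: (val p) p2 => [|a [|b [|? ?]]] //= _ _.
move: pp; rewrite /is_path E /= => /and3P[/and3P[va ab _] /eqP bw _].
rewrite bw in E ab; exists a; first by rewrite in_setC common_nbrE // va.
by apply: val_inj; rewrite E two_pathE.
Qed.

Lemma sigma_nonadj : sigma v w = #|~: @edge_nbrs T (v : T, w : T)|.
Proof. by rewrite /sigma shortest_paths_nonadj card_imset. Qed.

Lemma sigma_through_nonadj x :
  sigma_through v w x = ((x : T) \notin @edge_nbrs T (v : T, w : T)).
Proof.
rewrite /sigma_through shortest_paths_nonadj; case: (boolP (x \in _)) => /= xU.
  apply: eq_card0 => p; rewrite [LHS]inE; apply/negP => /andP[/imsetP[z zU ->]].
  rewrite two_pathE !inE => /and3P[/or3P[] /eqP E xv xw]; try by rewrite E eqxx in xv xw.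
  by rewrite -E in_setC xU in zU.
rewrite -[RHS](cards1 (two_path x)); apply: eq_card => p; rewrite [LHS]inE [RHS]inE.
apply/andP/eqP => [[/imsetP[z zU ->]]|->].
  by rewrite two_pathE !inE => /and3P[/or3P[] /eqP -> xv xw]; rewrite ?eqxx in xv xw.
split; first by apply/imsetP; exists x; rewrite ?in_setC.
have := xU; rewrite common_nbrE // => /andP[vx xw].
rewrite two_pathE !inE eqxx orbT /=; apply/andP; split.
  by apply: contraTneq vx => ->; rewrite adj_irrefl.
by apply: contraTneq xw => ->; rewrite adj_irrefl.
Qed.

End NonAdjacent.

Hypothesis common_nbr : forall p, @adj T p.1 p.2 -> #|@edge_nbrs T p| < #|T|.

(** The factor 2 comes from ordered pairs. Pairs adjacent in G contribute nothing. *)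
Lemma betweenness_double x : (betweenness x *+ 2 =
  \sum_(p : T * T | adj p.1 p.2 && ((x : T) \notin @edge_nbrs T p)) edge_weight p)%R.
Proof.
pose f (a b : T) : rat :=
  if adj a b && ((x : T) \notin @edge_nbrs T (a, b)) then edge_weight (a, b) else 0%R.
transitivity (\sum_a \sum_b f a b)%R; last first.
  by rewrite pair_bigA [RHS]big_mkcond; apply: eq_bigr => -[].
rewrite (@sum_sym_rank T).
- congr (_ *+ 2)%R; apply: eq_bigr => v _; apply: eq_bigr => w vw; rewrite /f.
  have [Tvw|] := boolP (@adj T v w).
    rewrite sigma_through_nonadj ?sigma_nonadj ?(common_nbr (p := (v, w))) //.
    by case: (_ \notin _); rewrite /edge_weight ?GRing.mul1r ?GRing.mul0r.
  rewrite complementE; have [vwE|_] := eqVneq v w; first by rewrite vwE ltnn in vw.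
  by rewrite /= negbK => /sigma_through_adj ->; rewrite GRing.mul0r.
- by move=> a b; rewrite /f /edge_weight /edge_nbrs /= setUC compl_adj_sym.
- by move=> a; rewrite /f /= compl_adj_irrefl.
Qed.

End ComplementBetweenness.

(** * Near weights when a star component is not the whole complement *)

Section StarCenterComplement.
Variables (G : sgraph) (c x0 : complement G) (l : nat).
Local Notation T := (complement G).
Hypothesis c_center : star_center c.
Hypothesis deg_c : #|nbrs c| = l.
Hypothesis x0_out : x0 \notin c |: nbrs c.

(** The closed neighbourhood of c is a union of components: edges near c lie inside it, edges near
    [x0] outside. *)
Lemma edges_near_disjoint p : p \in edges_near c -> p \notin edges_near x0.
Proof.
have cl y z : adj y z -> (y \in c |: nbrs c) = (z \in c |: nbrs c).
  exact: star_center_closed c_center y z.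
rewrite !in_edges_near => /andP[e cp]; rewrite e /=; move: x0_out; apply: contraNN => xp.
have p12 := cl _ _ e.
have p1C : p.1 \in c |: nbrs c.
  by case/orP: cp => /cl cpE; rewrite ?cpE ?p12 ?cpE setU11.
by case/orP: xp => /cl <-; rewrite -?p12.
Qed.

(** An edge whose [edge_nbrs] is everything would be near both c and [x0]. *)
Lemma complement_edge_nbrs_proper (p : T * T) :
  adj p.1 p.2 -> #|edge_nbrs p| < #|T|.
Proof.
move=> e; rewrite ltn_neqAle max_card andbT; apply/negP => /eqP cardE.
have full : edge_nbrs p = setT by apply/eqP; rewrite eqEcard subsetT cardsT cardE /=.
have near y : p \in edges_near y by rewrite in_set e full in_setT.
by have := edges_near_disjoint (near c); rewrite near.
Qed.

(** Each edge of T is either near x or gives its weight to the betweenness of x, so the sum is the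
    total weight. *)
Lemma near_weight_betweenness (x : G) : (@near_weight T x + betweenness x *+ 2 =
  \sum_(p : T * T | adj p.1 p.2) edge_weight p)%R.
Proof.
rewrite betweenness_double; last exact: complement_edge_nbrs_proper.
rewrite [RHS](bigID (fun p : T * T => (x : T) \in edge_nbrs p)) /=.
by congr (_ + _)%R; apply: eq_bigl => p; rewrite inE.
Qed.

Lemma near_weight_uniform (b : rat) : (forall x : G, betweenness x = b) ->
  forall x y : T, near_weight x = near_weight y.
Proof.
move=> bE x y; apply: (GRing.addIr (b *+ 2)%R).
by rewrite -{1}(bE x) -(bE y) !near_weight_betweenness.
Qed.

(** Edges near [x0] are not near c, hence all of them contribute to the betweenness of c. *)
Lemma near_weight_le_betweenness : (near_weight x0 <= @betweenness G c *+ 2)%R.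
Proof.
have pos p : @adj T p.1 p.2 -> (0 <= edge_weight p)%R.
  by move=> e; apply/ltW/edge_weight_gt0 => //; apply: complement_edge_nbrs_proper.
rewrite betweenness_double; last exact: complement_edge_nbrs_proper.
rewrite [leRHS](bigID (mem (edges_near x0))) /= -[leLHS]GRing.addr0 lerD //.
  rewrite le_eqVlt; apply/orP; left; apply/eqP/eq_bigl => p.
  have [p0|] := boolP (p \in edges_near x0); last by rewrite andbF.
  have := contraL (@edges_near_disjoint p) p0; rewrite inE negb_and.
  move: p0; rewrite inE => /andP[e _]; rewrite e => /= ->.
  by rewrite -[compl_adj _ _]/(@adj T p.1 p.2) e.
by apply: sumr_ge0 => p /andP[/andP[/pos]].
Qed.

(** The common near weight 2l / (n - l - 1) is at most 2b < 2. *)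
Lemma star_center_size_lt (b : rat) : (forall x : G, betweenness x = b) ->
  (b < 1)%R -> l < #|T| - l.+1.
Proof.
move=> bE b1; have := near_weight_le_betweenness.
rewrite (near_weight_uniform bE x0 c) star_center_weight // deg_c bE => le.
have : ((l.*2)%:R / (#|T| - l.+1)%:R < 2%:R :> rat)%R.
  by rewrite (le_lt_trans le) // ltr_pMn2r.
rewrite ltr_pdivrMr ?ltr0n.
  by rewrite -natrM ltr_nat mul2n ltn_double.
rewrite subn_gt0 -deg_c -card_cnbrs ltn_neqAle max_card andbT.
apply: contraNN x0_out => /eqP cardE.
suff -> : c |: nbrs c = setT by rewrite in_setT.
by apply/eqP; rewrite eqEcard subsetT cardsT cardE /=.
Qed.

End StarCenterComplement.

Theorem lemma27 (l : nat) (hl : l <= 4) :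
  ~ exists H : sgraph,
      exotic_coBUG H /\ exists x : H, isomorphic (component x) (star l).
Proof.
case=> H [[G [[_ [b bE b1]] not_stars] isoHG] [x x_star]]; apply: not_stars.
have [c0 c0_center deg_c0] := isomorphic_star_component x_star.
have [c c_center deg_c] := isomorphic_star_center isoHG c0_center.
rewrite {}deg_c0 in deg_c; exists l => y.
(* Either the complement is the single star around c, or some [x0] lies outside it and the
   near-weight argument applies. *)
have [/subsetP/(_ y isT)|/subsetPn[x0 _ x0_out]] :=
    boolP (complement G \subset c |: nbrs c).
  move=> yC; apply: star_center_isomorphic c_center deg_c _.
  rewrite (sym_connect_sym (@adj_sym _)).
  case/setU1P: yC => [->//|]; rewrite inE; exact: connect1.
have eqw := near_weight_uniform c_center x0_out bE.
have proper := complement_edge_nbrs_proper c_center x0_out.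
have l_lt := star_center_size_lt c_center deg_c x0_out bE b1.
have [c' yc' c'_center] := connect_star_center eqw proper c_center deg_c l_lt y hl.
apply: (star_center_isomorphic c'_center _ yc').
exact: (star_center_deg eqw proper c_center deg_c l_lt c'_center).
Qed.
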